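(* Let $p$ be a prime and let $m,k\ge 0$ be fixed integers satisfying $m+k<p$. Then for every integer $n\ge 0$, $$\mathcal{S}(p+n;(m,1^k))\equiv \mathcal{S}(n+1;(m,1^k)) \pmod p.$$
   Context: For integers $n,m,k\ge 0$, the mixed Stirling number of the second kind $\mathcal{S}(n;(m,1^k))$ is the number of ways to partition a set of $n$ distinct elements into $m$ unlabeled nonempty blocks and $k$ labeled nonempty blocks (the blocks labeled $1,\dots,k$; all $m+k$ blocks are pairwise disjoint with union the whole set, and unlabeled blocks are distinguished from labeled ones). Equivalently, $\mathcal{S}(n;(m,1^k))=\sum_{\ell=m}^{n-k}\binom{n}{\ell}{\ell \brace m}\,k!\,{n-\ell \brace k}$, where ${a \brace b}$ is the classical Stirling number of the second kind; the exponential generating function in $n$ is $(e^x-1)^{m+k}/m!$. *)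

(* Defs.v *)
From mathcomp Require Import all_boot.

Set Implicit Arguments.
Unset Strict Implicit.
Unset Printing Implicit Defensive.

(* A pair [(P, L)]: [P] is the set of the unlabeled blocks, [L i] the block
   labeled [i].  [partition P (~: U)] says that the unlabeled blocks are
   nonempty, pairwise disjoint, and cover exactly what the labeled ones miss. *)
Definition mixed_partition (T : finType) (m k : nat)
    (x : {set {set T}} * {ffun 'I_k -> {set T}}) : bool :=
  [&& #|x.1| == m,
      [forall i, x.2 i != set0],
      [forall i, forall j, (i != j) ==> [disjoint x.2 i & x.2 j]]
    & partition x.1 (~: \bigcup_(i < k) x.2 i)].

Definition mixed_stirling (n m k : nat) : nat :=
  #|[set x : {set {set 'I_n}} * {ffun 'I_k -> {set 'I_n}}
      | mixed_partition m x]|.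

(* Main.v *)
Require Import Defs.
From mathcomp Require Import all_boot.

Set Implicit Arguments.
Unset Strict Implicit.
Unset Printing Implicit Defensive.

(** Number the unlabeled blocks of a mixed partition in all [m!] possible ways.
    A mixed partition of [T] with numbered unlabeled blocks is the same thing
    as a surjection from [T] onto ['I_k + 'I_m], the blocks being its fibres,
    so [m!] times the mixed Stirling number counts surjections
    ([card_surj_mixed]).

    For any finite codomain, let [card_onto A n] count the functions on ['I_n]
    with image exactly [A].  Sorting all functions into [A] by their image gives
    [\sum_(B \subset A) card_onto B n = #|A| ^ n], and
    [#|A| ^ (p + n) = #|A| ^ (n + 1)] modulo [p] by Fermat's little theorem.
    Induction on [#|A|] then shows that [card_onto A (p + n)] and
    [card_onto A (n + 1)] are congruent modulo [p] ([card_onto_mod]).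
    Finally [m < p] makes [m!] invertible modulo [p], and it can be
    cancelled. *)

(** The number of functions from ['I_n] whose image is exactly [A]. *)
Definition card_onto (C : finType) (A : {set C}) (n : nat) : nat :=
  #|[set f : {ffun 'I_n -> C} | f @: [set: 'I_n] == A]|.

Lemma sum_card_onto (C : finType) (A : {set C}) (n : nat) :
  \sum_(B : {set C} | B \subset A) card_onto B n = #|A| ^ n.
Proof.
rewrite -[in RHS](card_ord n) -card_ffun_on -sum1_card.
rewrite (partition_big (fun f : {ffun 'I_n -> C} => f @: [set: 'I_n])
           (fun B : {set C} => B \subset A)) /=; last first.
  move=> f /ffun_onP fA; apply/subsetP => _ /imsetP[t _ ->]; exact: fA.
apply: eq_bigr => B BA; rewrite /card_onto -sum1dep_card.
apply: eq_bigl => f; case: eqP => [fB|]; last by rewrite andbF.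
rewrite andbT; apply/esym/ffun_onP => t.
by apply: (subsetP BA); rewrite -fB imset_f.
Qed.

Lemma card_onto_mod (p : nat) (hp : prime p) (C : finType) (n : nat)
    (A : {set C}) :
  card_onto A (p + n) = card_onto A (n + 1) %[mod p].
Proof.
(* Strong induction on [#|A|]: the terms [B != A] of [sum_card_onto] are
   congruent by induction, the totals by Fermat's little theorem. *)
have [r] := ubnP #|A|; elim: r A => // r IHr A ltAr.
have [/esym Ep /esym E1] :=
  (sum_card_onto A (p + n), sum_card_onto A (n + 1)).
rewrite (bigD1 A) //= in Ep; rewrite (bigD1 A) //= in E1.
have Epow : #|A| ^ (p + n) = #|A| ^ (n + 1) %[mod p].
  by rewrite addn1 expnD expnS -modnMml fermat_little // modnMml.
have Esum : \sum_(B : {set C} | (B \subset A) && (B != A)) card_onto B (p + n)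
  = \sum_(B : {set C} | (B \subset A) && (B != A)) card_onto B (n + 1) %[mod p].
  rewrite -modn_summ -[RHS]modn_summ; congr (_ %% p).
  apply: eq_bigr => B /andP[sBA neBA]; apply: IHr.
  by apply: leq_trans (proper_card _) ltAr; rewrite properEneq neBA.
apply/eqP; move/eqP: Epow; rewrite Ep E1 -modnDmr Esum modnDmr.
by rewrite eqn_modDr.
Qed.

Section SurjectionsAndMixedPartitions.

Variables (T : finType) (m k : nat).

Local Notation labels := ('I_k + 'I_m)%type.

(** The mixed partition whose labeled blocks are the fibres of [f] over
    ['I_k], and whose unlabeled blocks are the fibres over ['I_m], their
    numbering being forgotten. *)
Definition fibre_blocks (f : {ffun T -> labels}) :
    {set {set T}} * {ffun 'I_k -> {set T}} :=
  ([set f @^-1: [set inr j] | j : 'I_m], [ffun i => f @^-1: [set inl i]]).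

Lemma disjoint_fibres (C : finType) (f : {ffun T -> C}) (c d : C) :
  c != d -> [disjoint f @^-1: [set c] & f @^-1: [set d]].
Proof.
move=> neq; rewrite disjoint_subset; apply/subsetP => t.
by rewrite !inE => /eqP->.
Qed.

Lemma surj_fibre_neq0 (C : finType) (f : {ffun T -> C}) (c : C) :
  f @: [set: T] = [set: C] -> f @^-1: [set c] != set0.
Proof.
move=> fT; have: c \in f @: [set: T] by rewrite fT.
by case/imsetP=> t _ ->; apply/set0Pn; exists t; rewrite !inE.
Qed.

Lemma fibre_inj (C : finType) (f : {ffun T -> C}) (c d : C) :
  f @: [set: T] = [set: C] -> f @^-1: [set c] = f @^-1: [set d] -> c = d.
Proof.
move=> fT Ecd; have /set0Pn[t tc] := surj_fibre_neq0 c fT.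
by move: (tc); rewrite Ecd !inE => /eqP <-; move: tc; rewrite !inE => /eqP.
Qed.

Lemma fibre_blocks_mixed (f : {ffun T -> labels}) :
  f @: [set: T] = [set: labels] -> mixed_partition m (fibre_blocks f).
Proof.
move=> fT; apply/and4P; split=> /=.
- rewrite card_imset ?card_ord // => i j /fibre_inj-/(_ fT).
  by case.
- by apply/forallP => i; rewrite ffunE surj_fibre_neq0.
- apply/forallP => i; apply/forallP => j; apply/implyP => neq_ij.
  by rewrite !ffunE disjoint_fibres //; apply: contraNneq neq_ij => -[->].
apply/and3P; split.
- apply/eqP/setP => t; rewrite inE; apply/bigcupP/idP.
    case=> _ /imsetP[j _ ->]; rewrite !inE => /eqP ft.
    by apply/bigcupP => -[i _]; rewrite ffunE !inE ft.
  move/bigcupP=> notL; case ft: (f t) => [i|j].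
    by case: notL; exists i; rewrite // ffunE !inE ft.
  by exists (f @^-1: [set inr j]); rewrite ?imset_f // !inE ft.
- apply/trivIsetP => _ _ /imsetP[i _ ->] /imsetP[j _ ->] neq_ij.
  by apply: disjoint_fibres; apply: contraNneq neq_ij => ->.
apply/imsetP => -[j _ E0].
by have := surj_fibre_neq0 (inr j) fT; rewrite -E0 eqxx.
Qed.

(** Any indexed family of nonempty, pairwise disjoint sets covering [T] is the
    family of fibres of a surjection. *)
Lemma surj_of_fibres (C : finType) (h : C -> {set T}) :
  (forall c, h c != set0) ->
  (forall c d t, t \in h c -> t \in h d -> c = d) ->
  (forall t, exists c, t \in h c) ->
  exists2 f : {ffun T -> C},
    f @: [set: T] = [set: C] & forall c, f @^-1: [set c] = h c.
Proof.
move=> h_neq0 h_disj h_cov; pose f := [ffun t => xchoose (h_cov t)].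
have fh c : f @^-1: [set c] = h c.
  apply/setP => t; rewrite !inE ffunE; have xP := xchooseP (h_cov t).
  by apply/eqP/idP => [<- //|tc]; apply: h_disj xP tc.
exists f => //; apply/setP => c; rewrite [RHS]inE.
have /set0Pn[t] := h_neq0 c; rewrite -fh !inE => /eqP <-.
by rewrite imset_f.
Qed.

(** A surjection with given blocks amounts to a numbering by ['I_m] of the [m]
    unlabeled blocks. *)
Lemma card_surj_with_blocks (x : {set {set T}} * {ffun 'I_k -> {set T}}) :
  mixed_partition m x ->
  #|[set f : {ffun T -> labels}
     | (f @: [set: T] == [set: labels]) && (fibre_blocks f == x)]| = m`!.
Proof.
case: x => P L /and4P[/= /eqP cardP /forallP L_neq0 /forallP L_disj partP].
have [/eqP covP trivP P_neq0] := and3P partP.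
pose numbering (f : {ffun T -> labels}) := [ffun j : 'I_m => f @^-1: [set inr j]].
(* A surjection with blocks [(P, L)] is determined by its numbering, since its
   fibres over ['I_k] are given by [L]. *)
rewrite -(card_in_imset (f := numbering)); last first.
  move=> f1 f2; rewrite !inE => /andP[_ /eqP[_ L1]] /andP[_ /eqP[_ L2]] Enum.
  have Efib c : f1 @^-1: [set c] = f2 @^-1: [set c].
    case: c => [i|j]; last by have /ffunP/(_ j) := Enum; rewrite !ffunE.
    by have /ffunP/(_ i) := etrans L1 (esym L2); rewrite !ffunE.
  apply/ffunP => t; have /setP/(_ t) := Efib (f1 t).
  by rewrite !inE eqxx => /esym/eqP.
(* The numberings that occur are the injections of ['I_m] into [P]. *)
have -> : m`! = #|P| ^_ #|'I_m| by rewrite cardP card_ord ffactnn.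
rewrite -card_inj_ffuns_on.
apply: eq_card => g; rewrite inE; apply/imsetP/andP.
  case=> f; rewrite inE => /andP[/eqP fT /eqP[EP _]] ->; split.
    by apply/ffun_onP => j; rewrite ffunE -EP imset_f.
  apply/injectiveP => i j; rewrite !ffunE => /fibre_inj-/(_ fT).
  by case.
case=> /ffun_onP gP /injectiveP g_inj.
have gT : [set g j | j : 'I_m] = P.
  apply/eqP; rewrite eqEcard card_imset // card_ord cardP leqnn andbT.
  by apply/subsetP => _ /imsetP[j _ ->]; apply: gP.
pose h (c : labels) := match c with inl i => L i | inr j => g j end.
have notLP i j t : t \in L i -> t \in g j -> False.
  move=> tL tg; have: t \in cover P by apply/bigcupP; exists (g j).
  by rewrite covP inE => /bigcupP[]; exists i.
have [f fT fh] : exists2 f : {ffun T -> labels},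
    f @: [set: T] = [set: labels] & forall c, f @^-1: [set c] = h c.
  apply: surj_of_fibres.
  - case=> [i|j] /=; first exact: L_neq0.
    by apply: contraNneq P_neq0 => <-; apply: gP.
  - case=> [i|i] [j|j] t //= ti tj.
    + congr inl; apply/eqP; apply: contraTT tj => neq_ij.
      have /forallP/(_ j)/implyP/(_ neq_ij) := L_disj i.
      by move/disjointFr => /(_ t ti) ->.
    + by case: (notLP i j t).
    + by case: (notLP j i t).
    congr inr; apply: g_inj; apply/eqP; apply: contraTT tj => neq_ij.
    by have /disjointFr/(_ ti) -> := trivIsetP trivP _ _ (gP i) (gP j) neq_ij.
  move=> t; have [/bigcupP[i _ ti]|tNL] := boolP (t \in \bigcup_(i < k) L i).
    by exists (inl i).
  have: t \in cover P by rewrite covP inE.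
  by rewrite -gT => /bigcupP[_ /imsetP[j _ ->] tj]; exists (inr j).
exists f; last by apply/ffunP => j; rewrite ffunE fh.
rewrite inE fT eqxx -gT; apply/eqP; congr pair.
  by apply: eq_imset => j; rewrite fh.
by apply/ffunP => i; rewrite ffunE fh.
Qed.

Lemma card_surj_mixed :
  #|[set f : {ffun T -> labels} | f @: [set: T] == [set: labels]]|
  = #|[set x : {set {set T}} * {ffun 'I_k -> {set T}} | mixed_partition m x]|
    * m`!.
Proof.
rewrite -sum1dep_card.
rewrite (partition_big fibre_blocks (fun x => mixed_partition m x)) /=;
  last first.
  by move=> f /eqP; apply: fibre_blocks_mixed.
rewrite -sum_nat_cond_const; apply: eq_bigr => x xP.
by rewrite sum1dep_card card_surj_with_blocks.
Qed.

End SurjectionsAndMixedPartitions.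

Lemma eqn_mod_pmul2r (p a b c : nat) :
  coprime p c -> (a * c == b * c %[mod p]) = (a == b %[mod p]).
Proof.
move=> co_pc; wlog le_ba : a b / b <= a => [H|].
  by case/orP: (leq_total b a) => /H // E; rewrite eq_sym E eq_sym.
by rewrite !eqn_mod_dvd ?leq_mul // -mulnBl Gauss_dvdl.
Qed.

Lemma coprime_prime_fact (p m : nat) : prime p -> m < p -> coprime p m`!.
Proof.
move=> hp; elim: m => [|m IHm] ltmp; first by rewrite coprimen1.
rewrite factS coprimeMr IHm 1?ltnW // andbT prime_coprime //.
by rewrite gtnNdvd.
Qed.

Theorem theorem3p19 (p m k : nat) (hp : prime p) (hmk : m + k < p) (n : nat) :
  mixed_stirling (p + n) m k = mixed_stirling (n + 1) m k %[mod p].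
Proof.
have ltmp : m < p := leq_ltn_trans (leq_addr k m) hmk.
apply/eqP; rewrite -(eqn_mod_pmul2r _ _ (coprime_prime_fact hp ltmp)).
rewrite /mixed_stirling -!card_surj_mixed.
by apply/eqP; apply: card_onto_mod.
Qed.
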